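(* Let $\theta<\lambda<\kappa$ be infinite cardinals with $\kappa$ regular, suppose $\mathrm{ubd}(J^{\mathrm{bd}}[\lambda],\theta)$ holds, let $S$ be a stationary subset of $E^\kappa_\lambda$ and $T\subseteq\kappa$ a stationary set of limit ordinals. Then for every $C$-sequence $\vec C=\langle C_\delta\mid\delta<\kappa\rangle$ such that $\vec C\restriction S$ witnesses $\mathrm{CG}_\lambda(S,T)$, there exists a $C$-sequence $\vec C^\bullet=\langle C^\bullet_\delta\mid\delta<\kappa\rangle$ such that: (a) $\vec C^\bullet\restriction S$ is $\lambda$-bounded; (b) if $\vec C$ is weakly coherent then so is $\vec C^\bullet$; (c) for every infinite cardinal $\chi\in[\theta,\kappa)$, if $\vec C$ is $\sqsubseteq_\chi$-coherent then so is $\vec C^\bullet$; (d) $\theta\in\Theta_1(\vec C^\bullet\restriction S,T)$.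
   Context: $E^\kappa_\lambda=\{\alpha<\kappa\mid\mathrm{cf}(\alpha)=\lambda\}$, $E^\kappa_{\ge\chi}$ analogously. For a set of ordinals $A$, $\mathrm{acc}(A)=\{\alpha\in A\mid\sup(A\cap\alpha)=\alpha>0\}$. A $C$-sequence over a set $X$ of ordinals is $\langle C_\delta\mid\delta\in X\rangle$ with each $C_\delta$ a closed subset of $\delta$ with $\sup(C_\delta)=\sup(\delta)$; $\lambda$-bounded means $\mathrm{otp}(C_\delta)\le\lambda$. A $C$-sequence over $\kappa$ is weakly coherent if $|\{C_\delta\cap\alpha\mid\delta<\kappa\}|<\kappa$ for every $\alpha<\kappa$, and $\sqsubseteq_\chi$-coherent if $C_{\bar\delta}=C_\delta\cap\bar\delta$ for all $\delta<\kappa$ and $\bar\delta\in\mathrm{acc}(C_\delta)\cap E^\kappa_{\ge\chi}$. $\mathrm{CG}_\lambda(S,T)$ for a $C$-sequence over $S$ means: it is $\lambda$-bounded and for every club $D\subseteq\kappa$ there is $\delta\in S$ with $\sup\{\beta<\delta\mid\min(C_\delta\setminus(\beta+1))\in D\cap T\}=\delta$. $\Theta_1(\vec C,T)$ (for $\vec C$ over $S$) is the set of cardinals $\theta$ for which there exists $h:\kappa\to\theta$ such that for every club $D\subseteq\kappa$ there is $\delta\in S$ such that for every $\tau<\theta$, $\sup\{\beta<\delta\mid h(\mathrm{otp}(C_\delta\cap\beta))=\tau\ \&\ \min(C_\delta\setminus(\beta+1))\in D\cap T\}=\delta$. $J^{\mathrm{bd}}[\lambda]$ is the ideal of bounded subsets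 of $\lambda$. For an ideal $J$ over $\lambda$, $\mathrm{ubd}(J,\theta)$ asserts the existence of $c:[\lambda]^2\to\theta$ with $c(\alpha,\beta)<\beta$ for all $\alpha<\beta$, such that for every $B\in J^+$ there is $\eta<\lambda$ with $\mathrm{otp}(\{c(\eta,\beta)\mid\beta\in B,\ \eta<\beta\})=\theta$. *)

(* Defs.v *)
From mathcomp Require Import all_boot all_order.
From mathcomp Require Import boolp classical_sets functions cardinality.

Set Implicit Arguments.
Unset Strict Implicit.
Unset Printing Implicit Defensive.
Import Order.TTheory.

Local Open Scope classical_set_scope.
Local Open Scope card_scope.
Local Open Scope order_scope.

(* A regular cardinal kappa is represented by a well-ordered type K whose order
   type is kappa; the elements of K are then the ordinals below kappa, and an
   ordinal a < kappa, seen as a set of ordinals, is [below a].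

   Suprema, minima and order types are relations ("s is the supremum of A")
   since K has no default element and unbounded sets have no supremum in K.
   The library's [isLub A s] agrees with sup A = s for ordinals: in particular
   the only least upper bound of the empty set is the least element 0. *)

Section Ordinals.
Context {d : Order.disp_t} {K : orderType d}.
Implicit Types (A B D S T X : set K) (C : K -> set K) (J : set (set K)).
Implicit Types (a b u delta theta lambda chi : K).

Definition below a : set K := [set x | x < a].

Definition is_min A m := A m /\ lbound A m.

Definition is_otp A a :=
  exists f : K -> K, set_bij A (below a) f /\
    forall x y, A x -> A y -> x < y -> f x < f y.

Definition card_lt (U V : Type) (P : set U) (Q : set V) : Prop :=
  P #<= Q /\ ~ (Q #<= P).

Definition is_cardinal a := forall b, b < a -> card_lt (below b) (below a).

Definition infinite_cardinal a := is_cardinal a /\ infinite_set (below a).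

Definition has_cofinal_map A B :=
  exists f : K -> K, (forall x, A x -> B (f x)) /\
    forall y, B y -> exists2 x, A x & y <= f x.

Definition is_cf a mu := is_min [set nu | has_cofinal_map (below nu) (below a)] mu.

(* E^kappa_lambda and E^kappa_{>= chi} *)
Definition E_cf lambda : set K := [set a | is_cf a lambda].
Definition E_cf_ge chi : set K := [set a | exists2 mu, is_cf a mu & chi <= mu].

(* [limit_point A a] is sup (A `&` a) = a > 0. *)
Definition limit_point A a :=
  isLub (A `&` below a) a /\ exists b, b < a.

Definition acc A : set K := A `&` limit_point A.

Definition closed_in X A :=
  A `<=` X /\ forall a, X a -> limit_point A a -> A a.

Definition club D := closed_in setT D /\ forall a, exists2 b, D b & a < b.

Definition stationary S := forall D, club D -> S `&` D !=set0.

Definition limit_ordinal a :=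
  (exists b, b < a) /\ forall b, b < a -> exists2 c, b < c & c < a.

(* A C-sequence over X is given by a total C : K -> set K of which only the
   values at elements of X matter; the restriction of C to S is thus expressed
   by passing S as the index set X. *)
Definition C_sequence X C :=
  forall delta, X delta ->
    closed_in (below delta) (C delta) /\
    exists2 s, isLub (C delta) s & isLub (below delta) s.

Definition bounded_C_sequence X lambda C :=
  forall delta, X delta -> exists2 a, is_otp (C delta) a & a <= lambda.

Definition weakly_coherent C :=
  forall a, card_lt (range (fun delta => C delta `&` below a)) [set: K].

Definition coherent chi C :=
  forall delta delta', (acc (C delta) `&` E_cf_ge chi) delta' ->
    C delta' = C delta `&` below delta'.

(* min (A \ (b + 1)) is defined and belongs to X; note that x >= b + 1 is
   x > b. *)
Definition next_in A b X :=
  exists2 m, is_min [set x | A x /\ b < x] m & X m.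

Definition CG lambda S T C :=
  C_sequence S C /\ bounded_C_sequence S lambda C /\
  forall D, club D -> exists2 delta, S delta &
    isLub [set b | b < delta /\ next_in (C delta) b (D `&` T)] delta.

(* The cardinals below kappa that belong to Theta_1 (C restricted to S, T). *)
Definition Theta1 S C T : set K := [set theta | is_cardinal theta /\
  exists2 h : K -> K, (forall x, h x < theta) &
    forall D, club D -> exists2 delta, S delta &
      forall tau, tau < theta ->
        isLub [set b | [/\ b < delta,
                 exists2 o, is_otp (C delta `&` below b) o & h o = tau
               & next_in (C delta) b (D `&` T)]] delta].

Definition Jbd lambda : set (set K) :=
  [set B | exists2 a, a < lambda & B `<=` below a].

Definition positive lambda J : set (set K) :=
  [set B | B `<=` below lambda /\ ~ J B].

(* J is meant to be an ideal over lambda. *)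
Definition ubd lambda J theta :=
  exists2 c : K -> K -> K,
    (forall a b, a < b -> b < lambda -> c a b < theta /\ c a b < b) &
    forall B, positive lambda J B -> exists2 eta, eta < lambda &
      is_otp [set c eta b | b in [set b | B b /\ eta < b]] theta.

End Ordinals.

(* The order type of K is an infinite regular cardinal. *)
Definition regular_cardinal d (K : orderType d) :=
  [/\ well_founded (fun x y : K => x < y),
      infinite_set [set: K],
      forall a : K, card_lt (below a) [set: K]
    & forall a : K, ~ has_cofinal_map (below a) [set: K]].

(* Main.v *)
(* Fix c witnessing ubd. For a club D and delta in S let B(D) be the set of
   otp(C_delta ∩ g) where g is in C_delta and the next point of C_delta lies in
   D ∩ T, and let E(D) be the set of colours c(eta, b) attained by cofinally many
   b in B(D). Some eta works for all clubs, in the sense that for each D there is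
   delta with |E(D)| = theta. As a decreasing chain of subsets of theta has
   length less than lambda, there is a club D0 such that, for every D, some such
   delta satisfies E(D ∩ D0) = E(D0); past a fixed index zeta all colours of
   B(D0) lie in E(D0).

   The desired colour at a point g of A = C_delta is the rank of c(eta, otp(A ∩ g))
   among the colours of the D0-good points before g of index at least zeta. This
   depends on A ∩ (g + 1) only, and eventually it is the rank in E(D0), so that
   every ordinal below theta is desired cofinally often. Now fix h : kappa ->
   theta such that each colour occurs cofinally in each block of theta consecutive
   ordinals, and obtain the new sequence by inserting fewer than theta ordinals
   above each g, just enough for the order type to reach a point where h is the
   desired colour. Locality of the construction gives (b) and (c), the new
   accumulation points having cofinality less than theta. *)

Require Import Defs.
From mathcomp Require Import all_boot all_order.
From mathcomp Require Import boolp classical_sets functions cardinality.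

Set Implicit Arguments.
Unset Strict Implicit.
Unset Printing Implicit Defensive.
Import Order.TTheory.

Local Open Scope order_scope.
Local Open Scope card_scope.
Local Open Scope classical_set_scope.

(** * Recursive choice along a well-founded relation, and injections between sets *)

(** The first condition on [P] says that it reads [f] only at predecessors of [x]. A choice [pick]
    made at once for all pairs [(x, f)] reduces the recursion to [Fix]; [v0] fills in the values
    away from the predecessors. *)
Lemma wf_choice (U V : Type) (R : U -> U -> Prop) (v0 : V)
    (P : U -> (U -> V) -> V -> Prop) :
  well_founded R ->
  (forall x f g v, (forall y, R y x -> f y = g y) -> P x f v -> P x g v) ->
  (forall x f, (forall y, R y x -> P y f (f y)) -> exists v, P x f v) ->
  exists f, forall x, P x f (f x).
Proof.
move=> wf loc ex.
pose ext x (rec : forall y, R y x -> V) y :=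
  if pselect (R y x) is left h then rec y h else v0.
have /choice[pick pickP] : forall p : U * (U -> V), exists v,
    (exists w, P p.1 p.2 w) -> P p.1 p.2 v.
  move=> [x f] /=; have [[w Pw]|nP] := pselect (exists w, P x f w).
    by exists w.
  by exists v0 => /nP.
pose f := Fix wf (fun=> V) (fun x rec => pick (x, ext x rec)).
have fE x : f x = pick (x, ext x (fun y _ => f y)).
  rewrite /f Fix_eq // => y g h gh; congr (pick (_, _)); apply/funext => z.
  by rewrite /ext; case: pselect => // *; apply: gh.
exists f => x; elim/(well_founded_ind wf): x => x IH.
have Ef y : R y x -> f y = ext x (fun y _ => f y) y.
  by rewrite /ext; case: pselect.
have [v Pv] := ex _ _ IH; rewrite fE.
apply: (loc x (ext x (fun y _ => f y))) => [y /Ef //|].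
by apply: (pickP (x, _)); exists v; apply: loc Pv.
Qed.

Lemma card_le_inj (U V : Type) (v0 : V) (A : set U) (B : set V) :
  A #<= B -> exists2 f : U -> V, (forall x, A x -> B (f x)) &
    (forall x y, A x -> A y -> f x = f y -> x = y).
Proof.
move=> /card_leP[f].
exists (fun x => if pselect (A x) is left h
                 then val (f (SigSub (mem_set h))) else v0) => [x Ax|x y Ax Ay].
  by case: pselect => // h; apply: set_valP.
case: pselect => // h; case: pselect => // h' /val_inj E.
have := @inj _ _ _ f (SigSub (mem_set h)) (SigSub (mem_set h')).
by rewrite !inE => /(_ I I E) /(congr1 val).
Qed.

Lemma injection_card_le (U V : Type) (A : set U) (B : set V) (f : U -> V) :
  (forall x, A x -> B (f x)) ->
  (forall x y, A x -> A y -> f x = f y -> x = y) -> A #<= B.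
Proof.
move=> fAB finj; have /injfunPex[g] : exists2 g : U -> V, set_fun A B g & set_inj A g.
  by exists f => // x y; rewrite !inE; apply: finj.
exact: inj_card_le.
Qed.

(** * Order types of initial segments of sets of ordinals *)

Section Rank.
Context {d : Order.disp_t} {K : orderType d} (reg : regular_cardinal K).
Implicit Types (A B P : set K) (a b x y : K).

Lemma lt_wf : well_founded (fun x y : K => x < y).
Proof. by case: reg. Qed.

Lemma ex_min P : P !=set0 -> exists m, is_min P m.
Proof.
move=> [x Px]; apply: contrapT => noP.
elim/(well_founded_ind lt_wf): x Px => x IH Px.
apply: noP; exists x; split=> // y Py; rewrite leNgt; apply/negP => yx.
exact: IH yx Py.
Qed.

(** Regularity of kappa in its working form: without a strict bound, [f] would map [below a]
    cofinally into [K]. *)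
Lemma bounded_below a (f : K -> K) : exists y, forall x, x < a -> f x < y.
Proof.
case: reg => _ _ _ /(_ a) nco; apply: contrapT => nb; apply: nco.
exists f; split=> // y _; apply: contrapT => h; apply: nb; exists y => x xa.
by rewrite ltNge; apply/negP => yf; apply: h; exists x.
Qed.

Lemma rank_exists : exists rk : set K -> K -> K, forall A x,
  is_min [set k | forall y, A y -> y < x -> rk A y < k] (rk A x).
Proof.
have [t0] : [set: K] !=set0.
  have [_ inf _ _] := reg.
  by apply/set0P/eqP => E; apply: inf; rewrite E; apply: finite_set0.
suff /choice[r rP] : forall A, exists r : K -> K, forall x,
    is_min [set k | forall y, A y -> y < x -> r y < k] (r x) by exists r.
move=> A; apply: (wf_choice t0 (R := fun x y => x < y) (P := fun x r v =>
  is_min [set k | forall y, A y -> y < x -> r y < k] v)) => [|x f g v fg [h1 h2]|x f _].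
- exact: lt_wf.
- split=> [y Ay yx|k hk]; first by rewrite -fg //; apply: h1.
  by apply: h2 => y Ay yx; rewrite fg //; apply: hk.
- have [y hy] := bounded_below x f.
  by apply: ex_min; exists y => z _; apply: hy.
Qed.

(* [rank A x] is the order type of [A `&` below x]; see rank_otp. *)
Definition rank : set K -> K -> K := sval (cid rank_exists).

Lemma rankP A x : is_min [set k | forall y, A y -> y < x -> rank A y < k] (rank A x).
Proof. exact: (svalP (cid rank_exists)). Qed.

Lemma rank_lt A x y : A x -> x < y -> rank A x < rank A y.
Proof. by move=> Ax xy; have [/(_ x Ax xy)] := rankP A y. Qed.

Lemma rank_le_ub A x k :
  (forall y, A y -> y < x -> rank A y < k) -> rank A x <= k.
Proof. by move=> h; have [_] := rankP A x; apply. Qed.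

Lemma rank_le A x y : x <= y -> rank A x <= rank A y.
Proof.
by move=> xy; apply: rank_le_ub => z Az zx; apply: rank_lt => //; apply: lt_le_trans xy.
Qed.

Lemma rank_lt_inv A x y : rank A x < rank A y -> x < y.
Proof. by rewrite !ltNge; apply: contra => /rank_le. Qed.

Lemma rank_inj A x y : A x -> A y -> rank A x = rank A y -> x = y.
Proof.
move=> Ax Ay E; case: (ltgtP x y) => // [xy|yx].
  by have := rank_lt Ax xy; rewrite E ltxx.
by have := rank_lt Ay yx; rewrite E ltxx.
Qed.

Lemma rank_surj A x k : k < rank A x -> exists y, [/\ A y, y < x & rank A y = k].
Proof.
elim/(well_founded_ind lt_wf): x => x IH kx.
have [y [Ay yx ky]] : exists y, [/\ A y, y < x & k <= rank A y].
  apply: contrapT => h; move: kx; rewrite ltNge => /negP; apply.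
  apply: rank_le_ub => y Ay yx; rewrite ltNge; apply/negP => ky.
  by apply: h; exists y.
move: ky; rewrite le_eqVlt => /orP[/eqP ->|]; first by exists y.
by move=> /(IH _ yx)[z [Az zy <-]]; exists z; split=> //; apply: lt_trans yx.
Qed.

Lemma rank_local A B x : (forall y, y < x -> A y <-> B y) -> rank A x = rank B x.
Proof.
elim/(well_founded_ind lt_wf): x => x IH AB.
have E y : y < x -> rank A y = rank B y.
  by move=> yx; apply: IH => // z zy; apply: AB; apply: lt_trans yx.
apply/le_anti/andP; split; apply: rank_le_ub => y hy yx.
  by rewrite E //; apply: rank_lt => //; apply/AB.
by rewrite -E //; apply: rank_lt => //; apply/AB.
Qed.

Lemma rank_incr A B (f : K -> K) x b :
  (forall y, A y -> y < x -> B (f y) /\ f y < b) ->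
  (forall y z, A y -> A z -> y < z -> z < x -> f y < f z) ->
  rank A x <= rank B b.
Proof.
elim/(well_founded_ind lt_wf): x b => x IH b fB fi.
apply: rank_le_ub => y Ay yx; have [By yb] := fB _ Ay yx.
apply: le_lt_trans (rank_lt By yb); apply: IH => // [z Az zy|z t Az At zt ty].
  have zx := lt_trans zy yx; split; first by have [] := fB _ Az zx.
  exact: fi.
by apply: fi => //; apply: lt_trans yx.
Qed.

Lemma rank_sub A B x : A `<=` B -> rank A x <= rank B x.
Proof. by move=> AB; apply: (@rank_incr _ _ id) => // y /AB. Qed.

Lemma rank_le_map A (f : K -> K) x b :
  (forall y, A y -> y < x -> f y < b) ->
  (forall y z, A y -> A z -> y < z -> z < x -> f y < f z) ->
  rank A x <= b.
Proof.
elim/(well_founded_ind lt_wf): x b => x IH b fB fi.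
apply: rank_le_ub => y Ay yx; apply: le_lt_trans (fB _ Ay yx).
apply: IH => // [z Az zy|z t Az At zt ty]; first exact: fi.
by apply: fi => //; apply: lt_trans yx.
Qed.

Lemma rank_otp A a : is_otp (A `&` below a) (rank A a).
Proof.
exists (rank A); split; last by move=> x y [Ax _] _; apply: rank_lt.
split=> [x [Ax xa]|x y|k]; first exact: rank_lt.
  by rewrite !inE => -[Ax _] [Ay _]; apply: rank_inj.
by move=> /rank_surj[y [Ay ya <-]]; exists y.
Qed.

(** If [k] were skipped, every rank would be below [k], so inverting [rank A] would send ordinals
    below [k] onto the unbounded set [A], against regularity. *)
Lemma rank_onto A k : (forall a, exists2 b, A b & a < b) -> exists2 x, A x & rank A x = k.
Proof.
move=> Aunb; apply: contrapT => nk.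
have /choice[g gP] : forall j, exists x, (exists2 y, A y & rank A y = j) ->
    A x /\ rank A x = j.
  move=> j; have [[y]|n] := pselect (exists2 y, A y & rank A y = j).
    by exists y.
  by exists k => /n.
have [y hy] := bounded_below k g; have [b Ab yb] := Aunb y.
have bk : rank A b < k.
  case: (ltgtP (rank A b) k) => // [/rank_surj[z [Az _ zk]]|E]; case: nk.
    by exists z.
  by exists b.
have [Ag /(rank_inj Ag Ab) E] := gP _ (ex_intro2 _ _ b Ab erefl).
by have := hy _ bk; rewrite E ltNge (ltW yb).
Qed.

End Rank.

(** * Infinite cardinals, pairing, and a colouring of kappa by blocks *)

Section InfiniteCardinals.
Context {d : Order.disp_t} {K : orderType d} (reg : regular_cardinal K).
Implicit Types (A B P : set K) (a b x y : K).
Local Notation rank := (rank reg).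

Lemma no_max a : exists b, a < b.
Proof.
apply: contrapT => nb.
have le_a x : x <= a by rewrite leNgt; apply/negP => ax; apply: nb; exists x.
have [[x xa]|nx] := pselect (exists x, x < a).
  by have [y hy] := bounded_below reg a (fun=> a); apply: nb; exists y; apply: hy xa.
have [_ inf _ _] := reg; apply: inf.
suff -> : [set: K] = [set a] by apply: finite_set1.
apply/seteqP; split=> // x _ /=; apply/le_anti; rewrite le_a /= leNgt.
by apply/negP => xa; apply: nx; exists x.
Qed.

Lemma infinite_cardinal_limit a b : infinite_cardinal a -> b < a ->
  exists2 c, b < c & c < a.
Proof.
move=> [card_a inf_a] ba; apply: contrapT => nc.
have lt_a x : x < a -> x = b \/ x < b.
  move=> xa; case: (ltgtP x b) => [||->]; [by right| |by left].
  by move=> bx; case: nc; exists x.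
have inf_b : infinite_set (below b).
  move=> fin_b; apply: inf_a; apply: (@sub_finite_set _ _ (below b `|` [set b])).
    by move=> x /lt_a[->|]; [right|left].
  by rewrite finite_setU; split=> //; apply: finite_set1.
have /infiniteP/(card_le_inj b)[e eb einj] := inf_b.
have [_] := card_a _ ba; apply.
(* Hilbert's hotel: [b], the top element of [below a], goes to [e 0], each [e n] moves to [e n.+1],
   and all else stays. *)
have /choice[f fP] : forall x, exists y, [/\ x = b -> y = e 0%N,
    forall n, x = e n -> y = e n.+1 & x <> b -> (forall n, x <> e n) -> y = x].
  move=> x; have [->|xb] := pselect (x = b).
    exists (e 0%N); split=> // n E.
    by have := eb n I; rewrite -E /below /= ltxx.
  have [[n ->]|xe] := pselect (exists n, x = e n).
    exists (e n.+1); split=> // [E|m /(einj _ _ I I) -> //|_ /(_ n)//].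
    by have := eb n I; rewrite E /below /= ltxx.
  by exists x; split=> // n E; case: xe; exists n.
have cases x : x < a -> [\/ x = b /\ f x = e 0%N, exists n, x = e n /\ f x = e n.+1 |
    [/\ forall n, x <> e n, x < b & f x = x]].
  move=> xa; have [f1 f2 f3] := fP x.
  have [xb|xb] := pselect (x = b); first by constructor 1; split=> //; apply: f1.
  have [[n E]|xe] := pselect (exists n, x = e n).
    by constructor 2; exists n; split=> //; apply: f2.
  have ne n : x <> e n by move=> E; apply: xe; exists n.
  by constructor 3; split=> //; [case: (lt_a _ xa)|apply: f3].
apply: (injection_card_le (f := f)) => [x /cases[[_ ->]|[n [_ ->]]|[_ ? ->]]//|x y].
- exact: eb.
- exact: eb.
move=> /cases[[-> ->]|[n [-> ->]]|[ne _ ->]] /cases[[-> ->]|[m [-> ->]]|[me _ ->]] //.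
- by move=> /(einj _ _ I I).
- by move=> E; case: (me 0%N).
- by move=> /(einj _ _ I I).
- by move=> /(einj _ _ I I)[->].
- by move=> E; case: (me n.+1).
- by move=> E; case: (ne 0%N).
- by move=> E; case: (ne m.+1).
Qed.

Lemma card_le_setX (U V U' V' : Type) (A : set U) (B : set V) (A' : set U') (B' : set V')
    (u' : U') (v' : V') :
  A #<= A' -> B #<= B' -> A `*` B #<= A' `*` B'.
Proof.
move=> /(card_le_inj u')[f fA fi] /(card_le_inj v')[g gB gi].
apply: (injection_card_le (f := fun p => (f p.1, g p.2))) => [[x y] /= [Ax By]|].
  by split; [apply: fA|apply: gB].
by move=> [x y] [z t] [/= Ax By] [/= Az Bt] [/(fi _ _ Ax Az) -> /(gi _ _ By Bt) ->].
Qed.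

(* Goedel's well-ordering of pairs. *)
Definition pair_lt (p q : K * K) : Prop :=
  Order.max p.1 p.2 < Order.max q.1 q.2 \/
  Order.max p.1 p.2 = Order.max q.1 q.2 /\ (p.1 < q.1 \/ p.1 = q.1 /\ p.2 < q.2).

Lemma pair_lt_wf : well_founded pair_lt.
Proof.
suff H m x y : Order.max x y = m -> Acc pair_lt (x, y) by move=> [x y]; apply: H.
elim/(well_founded_ind (lt_wf reg)): m x y => m IHm x.
elim/(well_founded_ind (lt_wf reg)): x => x IHx y.
elim/(well_founded_ind (lt_wf reg)): y => y IHy xy.
constructor=> -[z t] [|[/= E [zx|[zx ty]]]] /=.
- by rewrite xy => /IHm; apply.
- by apply: IHx => //; rewrite E.
- by rewrite zx in E *; apply: IHy => //; rewrite E.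
Qed.

Lemma pair_lt_total p q : [\/ pair_lt p q, p = q | pair_lt q p].
Proof.
rewrite /pair_lt; case: (ltgtP (Order.max p.1 p.2) (Order.max q.1 q.2)) => m.
- by constructor 1; left.
- by constructor 3; left.
- case: (ltgtP p.1 q.1) => pq1.
  + by constructor 1; right; split=> //; left.
  + by constructor 3; right; split=> //; left.
  + case: (ltgtP p.2 q.2) => pq2.
    * by constructor 1; right; split=> //; right.
    * by constructor 3; right; split=> //; right.
    * by constructor 2; move: pq1 pq2; case: p q {m} => [? ?] [? ?] /= -> ->.
Qed.

(** Hessenberg's theorem. A non-cardinal reduces to a smaller ordinal. If [a] is a cardinal, a
    proper initial segment of the pair order lies in the square of some [s < a], so it has size less
    than [a], and a value below [a] not taken at earlier pairs is always available. *)
Lemma infinite_below_square a : infinite_set (below a) ->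
  below a `*` below a #<= below a.
Proof.
elim/(well_founded_ind (lt_wf reg)): a => a IH inf_a.
have [[b ba le_ab]|ncard] := pselect (exists2 b, b < a & below a #<= below b).
  have inf_b : infinite_set (below b) by move=> /(card_le_finite le_ab).
  apply: card_le_trans (card_le_setX b b le_ab le_ab) _.
  apply: card_le_trans (IH _ ba inf_b) _.
  by apply: subset_card_le => x; rewrite /below /= => /lt_trans; apply.
have card_a : infinite_cardinal a.
  split=> // b ba; split; last by move=> ?; apply: ncard; exists b.
  by apply: subset_card_le => x; rewrite /below /= => /lt_trans; apply.
have small_seg q : below a q.1 -> below a q.2 ->
    ~ (below a #<= [set p | pair_lt p q]).
  case: q => x y /= xa ya le_a.
  have ma : Order.max x y < a by rewrite gt_max xa ya.
  have [s ms sa] := infinite_cardinal_limit card_a ma.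
  have {}le_a : below a #<= below s `*` below s.
    apply: card_le_trans le_a _; apply: subset_card_le => -[z t] zt.
    have : Order.max z t < s.
      by case: zt => [/lt_trans|[/= ->]]; [apply|].
    by rewrite gt_max => /andP[].
  have [fin_s|inf_s] := pselect (finite_set (below s)).
    by apply: inf_a; apply: card_le_finite le_a _; apply: finite_setX.
  by apply: ncard; exists s => //; apply: card_le_trans le_a (IH _ sa inf_s).
have [|q f g v fg h q1 q2|q f _|f fP] := wf_choice a (R := pair_lt)
    (P := fun q f v => below a q.1 -> below a q.2 ->
      v < a /\ forall p, pair_lt p q -> f p <> v).
- exact: pair_lt_wf.
- by have [va ne] := h q1 q2; split=> // p pq; rewrite -fg //; apply: ne.
- have [[q1 q2]|nq] := pselect (below a q.1 /\ below a q.2); last first.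
    by exists a => q1 q2; case: nq.
  apply: contrapT => nv; apply: (small_seg q) => //.
  apply: card_le_trans (card_image_le f _); apply: subset_card_le => v va.
  apply: contrapT => nf; apply: nv; exists v => _ _; split=> // p pq E.
  by apply: nf; exists p.
apply: (injection_card_le (f := f)) => [p [p1 p2]|p q [p1 p2] [q1 q2] E].
  by have [] := fP _ p1 p2.
case: (pair_lt_total p q) => // pq.
  by have [_ /(_ _ pq)] := fP _ q1 q2.
by have [_ /(_ _ pq)] := fP _ p1 p2; rewrite E.
Qed.

(** [g] is the second coordinate of the inverse of a pairing [p]. The fibre over [t] contains all
    [p (a, t)], hence is too large to be bounded in the cardinal [theta]. *)
Lemma unbounded_fibres theta : infinite_cardinal theta ->
  exists2 g : K -> K, forall x, g x < theta &
    forall t r, t < theta -> r < theta -> exists s, [/\ r < s, s < theta & g s = t].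
Proof.
move=> card_theta; have [_ inf_theta] := card_theta.
have [t0 t0_theta] := infinite_setN0 inf_theta.
have [p p_theta p_inj] := card_le_inj t0 (infinite_below_square inf_theta).
have /choice[g gP] : forall s, exists t, t < theta /\
    forall a b, a < theta -> b < theta -> p (a, b) = s -> t = b.
  move=> s; have [[a [b [ha hb <-]]]|n] := pselect (exists a b,
      [/\ a < theta, b < theta & p (a, b) = s]).
    exists b; split=> // a' b' ha' hb'.
    by move=> /(p_inj (a', b') (a, b) (conj ha' hb') (conj ha hb))[].
  by exists t0; split=> // a b ha hb E; case: n; exists a, b.
exists g => [x|t r tt rt]; first by have [] := gP x.
apply: contrapT => ns; have [s rs st] := infinite_cardinal_limit card_theta rt.
have [/(_ s st)[_ nle] _] := card_theta; apply: nle.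
apply: (injection_card_le (f := fun a => p (a, t))) => [a ha|a b ha hb]; last first.
  by move=> /(p_inj (a, t) (b, t) (conj ha tt) (conj hb tt))[].
apply: le_lt_trans rs; rewrite leNgt; apply/negP => rp; apply: ns.
exists (p (a, t)); split=> //; first exact: p_theta.
by have [_ /(_ _ _ ha tt erefl)] := gP (p (a, t)).
Qed.

Lemma above_unbounded e a : exists2 b, e <= b & a < b.
Proof.
have [b ab] := no_max a; have [c ec] := no_max e.
by exists (Order.max b c); rewrite ?le_max ?lt_max ?(ltW ec) ?orbT ?ab.
Qed.

(* Colour each block of theta consecutive ordinals so that every colour below
   theta occurs cofinally in the block. *)
Lemma block_colouring theta : infinite_cardinal theta ->
  exists (h : K -> K) (nx : K -> K -> K), (forall x, h x < theta) /\
    forall e t, [/\ e < nx e t, rank [set z | e <= z] (nx e t) < theta &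
      t < theta -> h (nx e t) = t].
Proof.
move=> card_theta; have [g g_theta g_fib] := unbounded_fibres card_theta.
have [t0 t0_theta] := infinite_setN0 card_theta.2.
pose up e := [set z : K | e <= z].
(* [st x] is the start of the block of [x]: the least ordinal from which fewer than [theta] ordinals
   lead up to [x]. *)
have /choice[st stP] : forall x, exists e, is_min [set e | e <= x /\ rank (up e) x < theta] e.
  move=> x; apply: ex_min => //; exists x; split=> //.
  apply: le_lt_trans t0_theta; apply: rank_le_ub => y xy.
  by rewrite ltNge xy.
have up_antitone e e' x : e <= e' -> rank (up e') x <= rank (up e) x.
  by move=> ee'; apply: rank_sub => z; apply: le_trans.
pose h x := g (rank (up (st x)) x).
have next e t : t < theta -> exists n, [/\ e < n, rank (up e) n < theta & h n = t].
  move=> tt; have [[se rse] ste] := stP e.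
  have [s [rs stheta gs]] := g_fib t _ tt rse.
  have [n sn rn] := rank_onto reg s (above_unbounded (st e)).
  have en : e < n by apply: (rank_lt_inv (reg := reg) (A := up (st e))); rewrite rn.
  exists n; split=> //; first by apply: le_lt_trans (up_antitone _ _ _ se) _; rewrite rn.
  (* [e] and [n] share a block: [n] is fewer than [theta] steps above [st e], and a start that
     serves [n] and is at most [e] also serves [e]. *)
  suff E : st n = st e by rewrite /h E rn.
  have [[sn' rn'] stn] := stP n; apply/le_anti/andP; split.
    by apply: stn; split; [|rewrite rn].
  have [sne|/ltW] := leP (st n) e; last exact: le_trans.
  apply: ste; split=> //.
  by apply: le_lt_trans rn'; apply: rank_le; apply: ltW.
have /choice[nx nxP] : forall p : K * K, exists n, [/\ p.1 < n, rank (up p.1) n < theta &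
    p.2 < theta -> h n = p.2].
  move=> [e t] /=; have [tt|tt] := pselect (t < theta).
    by have [n [? ? ?]] := next e t tt; exists n; split.
  by have [n [? ? _]] := next e t0 t0_theta; exists n; split.
exists h, (fun e t => nx (e, t)); split=> [x|e t]; first exact: g_theta.
exact: nxP (e, t).
Qed.
End InfiniteCardinals.

(** * Closed unbounded subsets of kappa *)

Section Clubs.
Context {d : Order.disp_t} {K : orderType d} (reg : regular_cardinal K).
Implicit Types (A B D : set K) (a b x y : K).

Lemma limit_pointP A a : limit_point A a <->
  (exists b, b < a) /\ forall y, y < a -> exists x, [/\ A x, y < x & x < a].
Proof.
split=> [[[_ lub] ne]|[ne unb]]; split=> //.
  move=> y ya; apply: contrapT => nx; move: ya; rewrite ltNge => /negP; apply.
  apply: lub => x [Ax xa]; rewrite leNgt; apply/negP => yx.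
  by apply: nx; exists x.
split=> [x [_ xa]|u ub]; first exact: ltW.
rewrite leNgt; apply/negP => /unb[x [Ax ux xa]].
by have := ub x (conj Ax xa); rewrite leNgt ux.
Qed.

Context {theta : K} (theta_card : infinite_cardinal theta).

(** An infinite [theta] below the regular kappa rules out countable cofinality: sequences are
    indexed through a copy of the naturals in [below theta]. *)
Lemma bounded_nat (e : nat -> K) : exists y, forall n, e n < y.
Proof.
have /infiniteP/(card_le_inj theta)[i i_theta i_inj] := theta_card.2.
have /choice[j jP] : forall x, exists n, forall k, x = i k -> k = n.
  move=> x; have [[n ->]|nn] := pselect (exists n, x = i n).
    by exists n => k /(i_inj _ _ I I).
  by exists 0%N => k E; case: nn; exists k.
have [y hy] := bounded_below reg theta (e \o j).
exists y => n; have /= := hy _ (i_theta n I).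
by rewrite -(jP _ n erefl).
Qed.

Lemma closure_point_above (s : K -> K) a :
  exists2 m, a < m & forall y, y < m -> s y < m.
Proof.
have /choice[nxt nxtP] : forall x, exists z, x < z /\ forall y, y <= x -> s y < z.
  move=> x; have [z xz] := no_max reg x; have [w hw] := bounded_below reg z s.
  exists (Order.max z w); split=> [|y yx]; first by rewrite lt_max xz.
  by rewrite lt_max hw ?orbT //; apply: le_lt_trans xz.
pose e n := iter n nxt a.
have [m [em minm]] : exists m, is_min [set m | forall n, e n < m] m.
  by apply: (ex_min reg); have [y hy] := bounded_nat e; exists y.
exists m => [|y ym]; first exact: em 0%N.
have [n yn] : exists n, y <= e n.
  apply: contrapT => nn; move: ym; rewrite ltNge => /negP; apply.
  by apply: minm => n; rewrite ltNge; apply/negP => yn; apply: nn; exists n.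
by apply: lt_trans (em n.+1); apply: (nxtP _).2.
Qed.

Lemma club_closure_points (s : K -> K) : club [set m | forall y, y < m -> s y < m].
Proof.
split=> [|a]; last by have [m am sm] := closure_point_above s a; exists m.
split=> // a _ /limit_pointP[_ lim] y /lim[m [sm ym]]; apply: lt_trans.
exact: sm.
Qed.

Lemma club_setT : club [set: K].
Proof. by split=> // a; have [b ab] := no_max reg a; exists b. Qed.

(** If [s x] exceeds, for each [i < a], some point of [D i] above [x], then a nonzero point closed
    under [s] is a limit point of every [D i]. *)
Lemma club_bigcap a (D : K -> set K) : (forall i, i < a -> club (D i)) ->
  club [set x | forall i, i < a -> D i x].
Proof.
move=> cl; split=> [|b].
  split=> // b _ /limit_pointP[ne lim] i ia.
  have [[_ Dcl] _] := cl _ ia; apply: Dcl => //; apply/limit_pointP; split=> // y /lim.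
  by move=> [x [Dx ? ?]]; exists x; split=> //; apply: Dx.
have /choice[pick pickP] : forall p : K * K, exists z, p.1 < a -> D p.1 z /\ p.2 < z.
  move=> [i x] /=; have [ia|nia] := pselect (i < a); last by exists b.
  by have [_ /(_ x)[z ? ?]] := cl _ ia; exists z.
have /choice[s sP] : forall x, exists y, forall i, i < a -> pick (i, x) < y.
  by move=> x; apply: (bounded_below reg a (fun i => pick (i, x))).
have [m bm sm] := closure_point_above s b.
exists m => // i ia; have [[_ Dcl] _] := cl _ ia; apply: Dcl => //.
apply/limit_pointP; split=> [|y ym]; first by exists b.
have [/= Dp yp] := pickP (i, y) ia; exists (pick (i, y)); split=> //.
by apply: lt_trans (sm _ ym); apply: sP.
Qed.

Lemma clubI D D' : club D -> club D' -> club (D `&` D').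
Proof.
move=> cD cD'; have [t0 t0_theta] := infinite_setN0 theta_card.2.
have [t1 t01 t1_theta] := infinite_cardinal_limit theta_card t0_theta.
have -> : D `&` D' = [set x | forall i, i < theta -> (if i == t0 then D else D') x].
  apply/seteqP; split=> [x [Dx D'x] i _|x h]; first by case: ifP.
  split; first by have := h _ t0_theta; rewrite eqxx.
  by have := h _ t1_theta; rewrite (gt_eqF t01).
by apply: club_bigcap => i _; case: ifP.
Qed.

End Clubs.

(** * Filling the gaps of a set of ordinals *)

Definition last_below d (K : orderType d) (A : set K) (g x : K) : Prop :=
  [/\ A g, g < x & forall y, A y -> y < x -> y <= g].

Section Fill.
Context {d : Order.disp_t} {K : orderType d} (reg : regular_cardinal K).
Implicit Types (A B : set K) (a b x y g : K).
Local Notation rank := (rank reg).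

Lemma cofinal_rank B x :
  (forall y, y < x -> exists z, [/\ B z, y <= z & z < x]) ->
  has_cofinal_map (below (rank B x)) (below x).
Proof.
move=> cof.
have /choice[g gP] : forall j, exists y, j < rank B x -> [/\ B y, y < x & rank B y = j].
  move=> j; have [/rank_surj[y yP]|n] := pselect (j < rank B x); first by exists y.
  by exists x => /n.
exists g; split=> [j /gP[] //|y /cof[z [Bz yz zx]]].
have zB := rank_lt reg Bz zx; exists (rank B z) => //.
by have [Bg _ /(rank_inj Bg Bz) ->] := gP _ zB.
Qed.

Lemma last_belowW A g x y : last_below A g x -> g < y -> y <= x -> last_below A g y.
Proof.
move=> [Ag _ h] gy yx; split=> // z Az zy.
by apply: h => //; apply: lt_le_trans yx.
Qed.

Lemma last_below_uniq A g g' x : last_below A g x -> last_below A g' x -> g = g'.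
Proof.
move=> [Ag gx h] [Ag' gx' h'].
by apply/le_anti; rewrite (h' _ Ag gx) (h _ Ag' gx').
Qed.

Lemma last_belowVlimit A x : (exists g, last_below A g x) \/
  (forall g, A g -> g < x -> exists g', [/\ A g', g < g' & g' < x]).
Proof.
have [|nl] := pselect (exists g, last_below A g x); [by left|right => g Ag gx].
apply: contrapT => ng; apply: nl; exists g; split=> // y Ay yx.
by rewrite leNgt; apply/negP => gy; apply: ng; exists y.
Qed.

Context {theta : K} (nx : K -> K -> K) (tgt : set K -> K -> K).
Context (nx_gt : forall e t, e < nx e t).
Context (nx_near : forall e t, rank [set z | e <= z] (nx e t) < theta).

(** Recursion on [x] with membership as the value: both ranks read [F A] only below [x]. The target
    sees [A] only up to [g], which is what [fill_local] rests on. *)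
Lemma fill_exists : exists F : set K -> set K, forall A x, F A x <-> A x \/
  exists g, last_below A g x /\
    rank (F A) x <= nx (rank (F A) g) (tgt (A `&` [set y | y <= g]) g).
Proof.
suff /choice[F FP] : forall A, exists B, forall x, B x <-> A x \/
  exists g, last_below A g x /\
    rank B x <= nx (rank B g) (tgt (A `&` [set y | y <= g]) g) by exists F.
move=> A; apply: (wf_choice False (R := fun x y => x < y) (P := fun x B v =>
    v <-> A x \/ exists g, last_below A g x /\
      rank B x <= nx (rank B g) (tgt (A `&` [set y | y <= g]) g)) (lt_wf reg)).
  move=> x B B' v BB' ->.
  have E y : y <= x -> rank B y = rank B' y.
    by move=> yx; apply: rank_local => z zy; rewrite BB' //; apply: lt_le_trans yx.
  split=> -[|[g [[Ag gx gl] gr]]]; [by left| |by left|]; right; exists g; split=> //.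
    by rewrite -!E // ltW.
  by rewrite !E // ltW.
by move=> x f _; eexists; split; apply.
Qed.

(* After each point g of A, fill A inserts an initial segment of the gap above g,
   long enough for the order type to reach the value prescribed by nx and tgt. *)
Definition fill : set K -> set K := sval (cid fill_exists).

Definition goal A g : K := nx (rank (fill A) g) (tgt (A `&` [set y | y <= g]) g).

Lemma fillP A x : fill A x <-> A x \/
  exists g, last_below A g x /\ rank (fill A) x <= goal A g.
Proof. exact: (svalP (cid fill_exists)). Qed.

Lemma fill_sub A : A `<=` fill A.
Proof. by move=> x Ax; apply/fillP; left. Qed.

Lemma fill_local A B a : (forall y, y < a -> A y <-> B y) ->
  forall x, x < a -> fill A x <-> fill B x.
Proof.
move=> AB x; elim/(well_founded_ind (lt_wf reg)): x => x IH xa.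
have {}IH y : y < x -> fill A y <-> fill B y.
  by move=> yx; apply: IH => //; apply: lt_trans xa.
have E y : y <= x -> rank (fill A) y = rank (fill B) y.
  by move=> yx; apply: rank_local => z zy; apply: IH; apply: lt_le_trans yx.
have L g : last_below A g x <-> last_below B g x.
  split=> -[Ag gx h]; (split=> //; first by apply/AB => //; apply: lt_trans xa);
  by move=> y Ay yx; apply: h => //; apply/AB => //; apply: lt_trans xa.
have G g : g < x -> goal A g = goal B g.
  move=> gx; rewrite /goal E ?(ltW gx) //; congr (nx _ (tgt _ _)).
  apply/seteqP; split=> y [Ay yg]; split=> //; apply/AB => //;
  by apply: le_lt_trans yg _; apply: lt_trans xa.
split=> /fillP[Ax|[g [lg]]].
- by apply: fill_sub; apply/AB.
- by rewrite E // G; [move=> ?; apply/fillP; right; exists g; split=> //; apply/L|case: lg].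
- by apply: fill_sub; apply/AB.
- by rewrite -E // -G; [move=> ?; apply/fillP; right; exists g; split=> //; apply/L|case: lg].
Qed.

Lemma goal_gt A g : rank (fill A) g < goal A g.
Proof. exact: nx_gt. Qed.

Lemma fill_rank_le_goal A g x y : last_below A g x -> fill A y -> y < x ->
  rank (fill A) y <= goal A g.
Proof.
move=> lg Fy yx; have [yg|gy] := leP y g.
  by apply: le_trans (ltW (goal_gt A g)); apply: rank_le.
have ly := last_belowW lg gy (ltW yx).
case/fillP: Fy => [Ay|[g' [lg' ry]]]; last by rewrite (last_below_uniq ly lg').
by have [_ _ /(_ _ Ay yx)] := lg; rewrite leNgt gy.
Qed.

Lemma fill_cofinal A x : (forall g, A g -> g < x -> exists g', [/\ A g', g < g' & g' < x]) ->
  forall y, fill A y -> y < x -> exists g, [/\ A g, y < g & g < x].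
Proof.
move=> nl y /fillP[Ay|[g [[Ag gy lg] _]]] yx; first exact: nl.
have [g' [Ag' gg' gx']] := nl _ Ag (lt_trans gy yx).
case: (ltgtP y g') => [yg'|g'y|E]; first by exists g'.
  by have := lg _ Ag' g'y; rewrite leNgt gg'.
by rewrite E; apply: nl => //.
Qed.

Lemma fill_limit_rank A g x : last_below A g x -> limit_point (fill A) x ->
  forall y, fill A y -> y < x -> rank (fill A) y < goal A g.
Proof.
move=> lg /limit_pointP[_ lim] y Fy /lim[z [Fz yz zx]].
by apply: lt_le_trans (fill_rank_le_goal lg Fz zx); apply: rank_lt.
Qed.

Lemma fill_limit_point A x : limit_point (fill A) x ->
  (forall g, A g -> g < x -> exists g', [/\ A g', g < g' & g' < x]) -> limit_point A x.
Proof.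
move=> /limit_pointP[ne lim] nl; apply/limit_pointP; split=> // y /lim[z [Fz yz zx]].
have [g [Ag zg gx]] := fill_cofinal nl Fz zx.
by exists g; split=> //; apply: lt_trans zg.
Qed.

(** A limit point lying in a gap of [A] belongs to the inserted segment: the earlier points have
    rank strictly below the goal, so its own rank is at most the goal. Any other limit point is one
    of [A]. *)
Lemma fill_closed A a : closed_in (below a) A -> closed_in (below a) (fill A `&` below a).
Proof.
move=> [_ Acl]; split=> [x []//|x xa].
move=> /limit_pointP[ne lim]; split=> //.
have lim_x : limit_point (fill A) x.
  by apply/limit_pointP; split=> // y /lim[z [[]]]; exists z.
have [[g lg]|nl] := last_belowVlimit A x; last first.
  by apply: fill_sub; apply: Acl => //; apply: fill_limit_point.
apply/fillP; right; exists g; split=> //.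
by apply: rank_le_ub => y; apply: (fill_limit_rank lg).
Qed.

(** The ranks of the points between [g] and [x] fall into the interval from [rank (fill A) g] to the
    goal, whose order type is less than [theta]. *)
Lemma fill_limit_cof A g x : last_below A g x -> limit_point (fill A) x ->
  exists2 nu, nu < theta & has_cofinal_map (below nu) (below x).
Proof.
move=> lg lim; pose B := fill A `&` [set y | g < y].
exists (rank B x).
  apply: le_lt_trans (nx_near (rank (fill A) g) (tgt (A `&` [set y | y <= g]) g)).
  apply: (@rank_incr _ _ _ _ _ (rank (fill A))) => [y [Fy gy] yx|y z [Fy _] _ yz _].
    split; last exact: (fill_limit_rank lg).
    by apply: rank_le; apply: ltW.
  exact: rank_lt.
apply: cofinal_rank => y yx; have [_ gx _] := lg.
have /limit_pointP[_ /(_ (Order.max y g))[|z []]] := lim; first by rewrite gt_max yx.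
by rewrite gt_max => Fz /andP[/ltW yz gz] zx; exists z; split.
Qed.

(** In a gap, ranks are bounded by the goal, and a goal past [lambda] would give a final segment of
    [lambda] order type below [theta]. Elsewhere, a rank reaching [lambda] would yield a cofinal map
    into [lambda] from the smaller [rank A x]. *)
Lemma fill_rank_lt lambda A a : infinite_cardinal lambda -> theta < lambda ->
  (forall nu, nu < lambda -> ~ has_cofinal_map (below nu) (below lambda)) ->
  (forall x, x < a -> rank A x < lambda) ->
  forall x, x < a -> rank (fill A) x < lambda.
Proof.
move=> card_l tl regl rA x; elim/(well_founded_ind (lt_wf reg)): x => x IH xa.
have [[g lg]|nl] := last_belowVlimit A x.
  have [_ gx _] := lg; have rg := IH _ gx (lt_trans gx xa).
  have gl : goal A g < lambda.
    rewrite ltNge; apply/negP => lg'.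
    have /(le_lt_trans (rank_le reg [set z | rank (fill A) g <= z] lg')) :=
      nx_near (rank (fill A) g) (tgt (A `&` [set y | y <= g]) g).
    move=> /lt_trans/(_ tl)/regl; apply; apply: cofinal_rank => y yl.
    exists (Order.max y (rank (fill A) g)).
    by rewrite /= le_max lexx orbT le_max lexx gt_max yl rg.
  have [c gc cl] := infinite_cardinal_limit card_l gl.
  apply: le_lt_trans cl; apply: rank_le_ub => y Fy yx.
  by apply: le_lt_trans gc; apply: fill_rank_le_goal yx.
apply: contrapT => /negP; rewrite -leNgt => lx; apply: (regl _ (rA _ xa)).
have /choice[f fP] : forall j, exists y, j < rank A x -> [/\ A y, y < x & rank A y = j].
  move=> j; have [/rank_surj[y yP]|n] := pselect (j < rank A x); first by exists y.
  by exists x => /n.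
exists (rank (fill A) \o f); split=> [j /fP[_ fx _]|y yl] /=.
  by apply: IH => //; apply: lt_trans xa.
have [z [Fz zx rz]] := rank_surj (lt_le_trans yl lx).
have [g [Ag zg gx]] := fill_cofinal nl Fz zx.
have rg := rank_lt reg Ag gx; exists (rank A g) => //.
have [Af _ /(rank_inj Af Ag) ->] := fP _ rg.
by rewrite -rz; apply: rank_le; apply: ltW.
Qed.

(** [room] says that the gap holds [theta] ordinals before [m]. If the goal were not reached, the
    gap would be filled completely and embed into an interval of type less than [theta]. The point
    whose rank is the goal is the last one inserted, so [m] comes next. *)
Lemma fill_hit A g m s : last_below A g m -> A m -> s < m ->
  theta <= rank [set z | g < z] s ->
  exists b, [/\ g < b, b < m, fill A b, rank (fill A) b = goal A g &
    forall y, fill A y -> b < y -> m <= y].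
Proof.
move=> lg Am sm room; have [_ gm _] := lg.
have /rank_surj[b [Fb bm rb]] : goal A g < rank (fill A) m.
  rewrite ltNge; apply/negP => rm.
  have Fy y : g < y -> y < m -> fill A y.
    move=> gy ym; apply/fillP; right; exists g; split.
      by apply: last_belowW (ltW ym).
    by apply: le_trans rm; apply: rank_le; apply: ltW.
  move: room; rewrite leNgt => /negP; apply.
  apply: le_lt_trans (nx_near (rank (fill A) g) (tgt (A `&` [set y | y <= g]) g)).
  apply: (@rank_incr _ _ _ _ _ (rank (fill A))) => [y gy ys|y z gy _ yz zs].
    split; first by apply: rank_le; apply: ltW.
    apply: lt_le_trans rm; apply: rank_lt; last exact: lt_trans sm.
    by apply: Fy => //; apply: lt_trans sm.
  apply: rank_lt => //; apply: Fy => //.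
  by apply: lt_trans yz _; apply: lt_trans sm.
exists b; split=> //; first by apply: (@rank_lt_inv _ _ reg (fill A)); rewrite rb goal_gt.
move=> y Fy by_; rewrite leNgt; apply/negP => ym.
have := fill_rank_le_goal lg Fy ym.
by rewrite leNgt -rb (rank_lt reg Fb by_).
Qed.

End Fill.

(** * Cofinality, regularity of lambda, and colours attained cofinally *)

Section Cofinality.
Context {d : Order.disp_t} {K : orderType d} (reg : regular_cardinal K).
Implicit Types (A B D S : set K) (C : K -> set K) (a b x y delta theta lambda : K).
Local Notation rank := (rank reg).

Lemma not_cofinal_bound nu B (f : K -> K) : ~ has_cofinal_map (below nu) B ->
  (forall x, x < nu -> B (f x)) -> exists2 y, B y & forall x, x < nu -> f x < y.
Proof.
move=> nco fB; apply: contrapT => nb; apply: nco; exists f; split=> // y By.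
apply: contrapT => nx; apply: nb; exists y => // x xnu.
by rewrite ltNge; apply/negP => yf; apply: nx; exists x.
Qed.

Lemma cf_min delta lambda nu : is_cf delta lambda -> nu < lambda ->
  ~ has_cofinal_map (below nu) (below delta).
Proof. by move=> [_ h] nl /h; rewrite leNgt nl. Qed.

Lemma cf_limit lambda delta b : infinite_cardinal lambda -> is_cf delta lambda ->
  b < delta -> exists2 c, b < c & c < delta.
Proof.
move=> card_l cf bd; apply: contrapT => nc.
have [t0 t0l] := infinite_setN0 card_l.2.
have [t1 t01 t1l] := infinite_cardinal_limit card_l t0l.
apply: (cf_min cf t1l); exists (fun=> b); split=> // y yd; exists t0 => //.
by rewrite leNgt; apply/negP => by_; apply: nc; exists y.
Qed.

Lemma cf_regular lambda delta : infinite_cardinal lambda -> is_cf delta lambda ->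
  forall nu, nu < lambda -> ~ has_cofinal_map (below nu) (below lambda).
Proof.
move=> card_l cf nu nl [f [fl fcof]]; have [[g [gd gcof]] _] := cf.
(* [g] need not be monotone; [g'] dominates its values up to [i], so that composing with a cofinal
   map into [lambda] stays cofinal in [delta]. *)
have /choice[g' g'P] : forall i, exists y, i < lambda ->
    y < delta /\ forall j, j <= i -> g j < y.
  move=> i; have [il|il] := pselect (i < lambda); last by exists i.
  have [c ic cl] := infinite_cardinal_limit card_l il.
  have [||y yd hy] := @not_cofinal_bound c (below delta) g.
  - exact: cf_min cl.
  - by move=> x xc; apply: gd; apply: lt_trans cl.
  - by exists y => _; split=> // j ji; apply: hy; apply: le_lt_trans ic.
apply: (cf_min cf nl); exists (g' \o f); split=> [x /fl/g'P[]//|y /gcof[j jl yj]].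
have [x xnu jf] := fcof _ jl; exists x => //=.
by apply: le_trans yj _; apply: ltW; apply: (g'P _ (fl _ xnu)).2.
Qed.

Lemma unbounded_card A : (forall a, exists2 b, A b & a < b) -> [set: K] #<= A.
Proof.
move=> Aunb; have /choice[g gP] : forall k, exists x, A x /\ rank A x = k.
  by move=> k; have [x ? ?] := rank_onto reg k Aunb; exists x.
apply: (injection_card_le (f := g)) => [x _|x y _ _ E]; first by have [] := gP x.
by have [_ <-] := gP x; have [_ <-] := gP y; rewrite E.
Qed.

Definition cofinal_colours lambda theta (c : K -> K -> K) eta B : set K :=
  [set t | t < theta /\ forall xi, xi < lambda ->
    exists b, [/\ B b, xi <= b & c eta b = t]].

Context {theta lambda : K} (theta_card : infinite_cardinal theta)
  (lambda_card : infinite_cardinal lambda) (theta_lambda : theta < lambda)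
  (lambda_regular : forall nu, nu < lambda -> ~ has_cofinal_map (below nu) (below lambda))
  (c : K -> K -> K) (c_lt : forall a b, a < b -> b < lambda -> c a b < theta).
Local Notation cofcol := (cofinal_colours lambda theta c).

(** Each colour that is not cofinal disappears past some [xi t]; the colours lie below
    [theta < lambda] and [lambda] is regular, so these bounds have a common one. *)
Lemma cofinal_colours_tail eta B : eta < lambda -> exists2 zeta, zeta < lambda &
  forall b, B b -> b < lambda -> zeta <= b -> eta < b /\ cofcol eta B (c eta b).
Proof.
move=> etal.
have /choice[xi xiP] : forall t, exists x, x < lambda /\ (t < theta -> ~ cofcol eta B t ->
    forall b, B b -> x <= b -> c eta b <> t).
  move=> t; have [[tt nc]|n] := pselect (t < theta /\ ~ cofcol eta B t); last first.
    by exists eta; split=> // tt nt; case: n.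
  apply: contrapT => nx; apply: nc; split=> // x xl; apply: contrapT => nb.
  apply: nx; exists x; split=> // _ _ b Bb xb E; apply: nb.
  by exists b.
have [|x _|y yl hy] := @not_cofinal_bound theta (below lambda) xi.
- exact: lambda_regular.
- by have [] := xiP x.
have [z yz zl] : exists2 z, Order.max y eta < z & z < lambda.
  by apply: infinite_cardinal_limit; rewrite // gt_max yl.
move: yz; rewrite gt_max => /andP[yz etaz]; exists z => // b Bb bl zb.
have etab := lt_le_trans etaz zb; split=> //.
apply: contrapT => nc; have ct := c_lt etab bl.
have [_ /(_ ct nc b Bb)] := xiP (c eta b); apply => //.
by apply: le_trans zb; apply: ltW; apply: lt_trans yz; apply: hy.
Qed.

Context (c_unbounded : forall B, positive lambda (Jbd lambda) B ->
  exists2 eta, eta < lambda & is_otp [set c eta b | b in [set b | B b /\ eta < b]] theta).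

(* The hypothesis on c is applied to a subset B' of B so sparse that, for every eta,
   all elements of B' above eta except the least one give cofinal colours. *)
Lemma cofinal_colours_large B : B `<=` below lambda ->
  (forall xi, xi < lambda -> exists2 b, B b & xi <= b) ->
  exists2 eta, eta < lambda & theta <= rank (cofcol eta B) theta.
Proof.
move=> Bl Bunb.
have /choice[zeta zetaP] : forall eta, exists z, eta < lambda -> z < lambda /\
    forall b, B b -> z <= b -> cofcol eta B (c eta b).
  move=> eta; have [etal|n] := pselect (eta < lambda); last by exists eta => /n.
  have [z zl hz] := cofinal_colours_tail B etal.
  by exists z => _; split=> // b Bb zb; have [] := hz b Bb (Bl _ Bb) zb.
(* [z i] bounds [zeta eta] for all [eta <= i] at once; the sequence [e] will reach at least [z] of
   each of its earlier values. *)
have /choice[z zP] : forall i, exists y, i < lambda -> y < lambda /\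
    forall eta, eta <= i -> zeta eta <= y.
  move=> i; have [il|n] := pselect (i < lambda); last by exists i => /n.
  have [k ik kl] := infinite_cardinal_limit lambda_card il.
  have [|eta etak|y yl hy] := @not_cofinal_bound k (below lambda) zeta.
  - exact: lambda_regular.
  - by have [] := zetaP _ (lt_trans etak kl).
  - exists y => _; split=> // eta etai; apply: ltW; apply: hy.
    exact: le_lt_trans ik.
have [|x f g v fg h xl|x f hf|e eP] := wf_choice theta (R := fun x y : K => x < y)
    (P := fun x e v => x < lambda -> B v /\ forall y, y < x -> e y < v /\ z (e y) <= v).
- exact: lt_wf.
- by have [Bv hv] := h xl; split=> // y yx; rewrite -fg //; apply: hv.
- have [xl|n] := pselect (x < lambda); last by exists x.
  have [|y yx|y yl hy] := @not_cofinal_bound x (below lambda)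
      (fun y => Order.max (f y) (z (f y))).
  + exact: lambda_regular.
  + have [Bf _] := hf _ yx (lt_trans yx xl); have fl := Bl _ Bf.
    by rewrite /below /= gt_max fl (zP _ fl).1.
  + have [b Bb yb] := Bunb _ yl; exists b => _; split=> // t tx.
    have := lt_le_trans (hy _ tx) yb; rewrite gt_max => /andP[? /ltW ?].
    by split.
have e_lt x y : x < y -> y < lambda -> e x < e y.
  by move=> xy yl; have [_ /(_ _ xy)[]] := eP _ yl.
have e_ge x : x < lambda -> x <= e x.
  elim/(well_founded_ind (lt_wf reg)): x => x IH xl; rewrite leNgt; apply/negP => ex.
  have := IH _ ex (lt_trans ex xl); rewrite leNgt => /negP; apply.
  exact: e_lt.
have eB x : x < lambda -> B (e x) by move=> /eP[].
pose B' := e @` below lambda.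
have [|eta etal [f [[fI finj fsurj] _]]] := c_unbounded (B := B').
  split=> [_ [x xl <-]|[a al B'a]]; first exact/Bl/eB.
  have /B'a : B' (e a) by exists a.
  by rewrite /below /= ltNge e_ge.
(* Index [k0] carries the one colour [t0] that may fail to be cofinal: every later [e k] is at least
   [z (e k0)], hence at least [zeta eta]. *)
exists eta => //; have [k0 [k0l etak0 k0min]] : exists k,
    [/\ k < lambda, eta < e k & forall k', k' < lambda -> eta < e k' -> k <= k'].
  have [|k [[kl ek] kmin]] := ex_min reg (P := [set k | k < lambda /\ eta < e k]).
    have [k etak kl] := infinite_cardinal_limit lambda_card etal.
    by exists k; split=> //; apply: lt_le_trans (e_ge _ kl).
  by exists k; split=> // k' k'l ek'; apply: kmin.
pose E := cofcol eta B; pose t0 := c eta (e k0).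
have img t : [set c eta b | b in [set b | B' b /\ eta < b]] t -> t = t0 \/ E t.
  move=> [_ [[k kl <-] etak] <-].
  have := k0min _ kl etak; rewrite le_eqVlt => /orP[/eqP <-|k0k]; [by left|right].
  apply: (zetaP _ etal).2; first exact: eB.
  have [_ /(_ _ k0k)[_]] := eP _ kl; apply: le_trans.
  by apply: (zP _ (Bl _ (eB _ k0l))).2; apply: ltW.
(* If the cofinal colours had type below [theta], adding [t0] would still give fewer than [theta]
   colours; [code] puts [t0] on top of the others. *)
rewrite leNgt; apply/negP => small.
have [s rs st] := infinite_cardinal_limit theta_card small.
have [/(_ s st)[_ nle] _] := theta_card; apply: nle.
have /choice[f' f'P] : forall i, exists t, i < theta ->
    (t = t0 \/ E t) /\ f t = i.
  move=> i; have [it|n] := pselect (i < theta); last by exists i.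
  by have [t /img tE <-] := fsurj _ it; exists t.
have rE t : E t -> rank E t < rank E theta by move=> Et; apply: rank_lt => //; have [] := Et.
pose code t := if t == t0 then rank E theta else rank E t.
apply: (injection_card_le (f := code \o f')) => [i it|i j it jt] /=.
  rewrite /code /below /=; case: eqP => // nt0; have [[//|/rE h] _] := f'P _ it.
  exact: lt_trans rs.
have [ti fi] := f'P _ it; have [tj fj] := f'P _ jt; rewrite -{2}fi -{2}fj.
rewrite /code; case: eqP => [->|ni]; case: eqP => [->|nj] //.
- by case: tj => [//|/rE h] E'; rewrite E' ltxx in h.
- by case: ti => [//|/rE h] E'; rewrite E' ltxx in h.
- case: ti => // Ei; case: tj => // Ej E'.
  by congr f; apply: rank_inj E'.
Qed.

End Cofinality.

(** * Uniformization and stabilization over clubs *)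

Section Guessing.
Context {d : Order.disp_t} {K : orderType d} (reg : regular_cardinal K).
Implicit Types (A B D S T : set K) (C : K -> set K) (a b x y delta theta lambda : K).
Local Notation rank := (rank reg).
Context {theta lambda : K} (theta_card : infinite_cardinal theta)
  (lambda_card : infinite_cardinal lambda) (theta_lambda : theta < lambda).

(** If every [i] failed at some club [F i], all indices would fail at the intersection of these
    clubs. *)
Lemma club_uniformize (Q : K -> set K -> K -> Prop) S :
  (forall i D D' delta, D `<=` D' -> Q i D delta -> Q i D' delta) ->
  (forall D, club D -> exists delta, S delta /\ exists2 i, i < lambda & Q i D delta) ->
  exists2 i, i < lambda & forall D, club D -> exists2 delta, S delta & Q i D delta.
Proof.
move=> Qmono Qex; apply: contrapT => ni.
have /choice[F FP] : forall i, exists D, i < lambda -> club D /\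
    forall delta, S delta -> ~ Q i D delta.
  move=> i; have [il|n] := pselect (i < lambda); last by exists setT.
  apply: contrapT => nD; apply: ni; exists i => // D cD.
  apply: contrapT => nd; apply: nD; exists D => _; split=> // delta Sd Qd.
  by apply: nd; exists delta.
have /Qex[delta [Sd [i il Qi]]] : club [set x | forall i, i < lambda -> F i x].
  by apply: (club_bigcap reg theta_card) => i /FP[].
have [_ /(_ _ Sd)] := FP _ il; apply; apply: Qmono Qi => x.
exact.
Qed.

(* Otherwise a strictly decreasing chain of length lambda of subsets of theta arises. *)
Lemma club_stabilize (E : set K -> K -> set K) S :
  (forall D D' delta, D `<=` D' -> E D delta `<=` E D' delta) ->
  (forall D delta, E D delta `<=` below theta) ->
  (forall D, club D -> exists2 delta, S delta & theta <= rank (E D delta) theta) ->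
  exists2 D, club D & forall D', club D' -> exists delta, [/\ S delta,
    theta <= rank (E (D' `&` D) delta) theta & E D delta `<=` E (D' `&` D) delta].
Proof.
move=> Emono Etheta Elarge; apply: contrapT => nD.
have /choice[F FP] : forall D, exists D', club D -> club D' /\ forall delta, S delta ->
    theta <= rank (E (D' `&` D) delta) theta -> ~ E D delta `<=` E (D' `&` D) delta.
  move=> D; have [cD|n] := pselect (club D); last by exists D => /n.
  apply: contrapT => nD'; apply: nD; exists D => // D' cD'.
  apply: contrapT => nd; apply: nD'; exists D' => _; split=> // delta Sd large sub.
  by apply: nd; exists delta.
have [|x f g v fg ->|x f _|D DE] := wf_choice [set: K] (R := fun x y : K => x < y)
  (P := fun i (D : K -> set K) v => v = [set x | forall j, j < i -> (F (D j) `&` D j) x]).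
- exact: lt_wf.
- by apply/seteqP; split=> t h j jx; have := h j jx; rewrite fg.
- by eexists.
have cD i : club (D i).
  elim/(well_founded_ind (lt_wf reg)): i => i IH; rewrite DE.
  apply: (club_bigcap reg theta_card) => j ji.
  by apply: (clubI reg theta_card); [apply: (FP _ _).1|]; apply: IH.
have Dsub i j : j < i -> D i `<=` F (D j) `&` D j.
  by move=> ji; rewrite {1}DE => x; apply.
(* One [delta] serves the whole chain, since [D lambda] lies inside every [F (D j)] with
   [j < lambda]; each step [j] then loses some colour [t j] at [delta] for good. *)
have [delta Sd large] := Elarge _ (cD lambda).
have /choice[t tP] : forall j, exists t, j < lambda ->
    E (D j) delta t /\ ~ E (F (D j) `&` D j) delta t.
  move=> j; have [jl|n] := pselect (j < lambda); last by exists j => /n.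
  have [_ /(_ _ Sd)] := FP _ (cD j); move=> /(_ _)/existsNP[|x /not_implyP ?]; last by exists x.
  apply: le_trans large _; apply: rank_sub; apply: Emono; exact: Dsub.
have t_neq i j : i < j -> j < lambda -> t i <> t j.
  move=> ij jl E'; have [_ ni] := tP _ (lt_trans ij jl); have [tj _] := tP _ jl.
  by apply: ni; rewrite E'; apply: Emono (tj); apply: Dsub.
have [/(_ _ theta_lambda)[_ nle] _] := lambda_card; apply: nle.
apply: (injection_card_le (f := t)) => [j jl|i j il jl E'].
  by apply: Etheta; have [] := tP _ jl; eauto.
case: (ltgtP i j) => // h; first by case: (t_neq _ _ h jl).
by case: (t_neq _ _ h il).
Qed.

End Guessing.

(** * C-sequences at points of cofinality lambda, and their fillings *)

Section CSequence.
Context {d : Order.disp_t} {K : orderType d} (reg : regular_cardinal K).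
Implicit Types (A B D S T X : set K) (C : K -> set K) (a b x y delta theta lambda : K).
Local Notation rank := (rank reg).

Definition hits A X : set K := [set g | exists m, [/\ last_below A g m, A m & X m]].

(** The predecessor is the supremum [s] of the elements of [A] below [m]: were it not in [A], it
    would be a limit point of the closed set [A]. The point [x] makes the set of those elements
    nonempty. *)
Lemma last_below_ex A a b m x : closed_in (below a) A -> A m -> b < m ->
  (forall y, A y -> b < y -> m <= y) -> A x -> x <= b -> exists g, last_below A g m.
Proof.
move=> [Aa Acl] Am bm mmin Ax xb.
have [//|nl] := last_belowVlimit A m.
have Ab y : A y -> y < m -> y <= b.
  by move=> Ay ym; rewrite leNgt; apply/negP => /(mmin _ Ay); rewrite leNgt ym.
have [|s [sub smin]] := ex_min reg (P := [set s | forall y, A y -> y < m -> y <= s]).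
  by exists b.
have sb : s <= b by apply: smin.
have sm := le_lt_trans sb bm.
have nAs : ~ A s.
  move=> As; have [s' [As' ss' s'm]] := nl _ As sm.
  by have := sub _ As' s'm; rewrite leNgt ss'.
have lt_s y : A y -> y < m -> y < s.
  by move=> Ay ym; rewrite lt_neqAle sub // andbT; apply/eqP => E; apply: nAs; rewrite -E.
case: nAs; apply: Acl; first by apply: lt_trans (Aa _ Am).
apply/limit_pointP; split; first by exists x; apply: lt_s => //; apply: le_lt_trans bm.
move=> y ys; apply: contrapT => nz; move: ys; rewrite ltNge => /negP; apply.
apply: smin => z Az zm; rewrite leNgt; apply/negP => yz.
by apply: nz; exists z; split=> //; apply: lt_s.
Qed.

Section LimitOrdinal.
Context {lambda delta : K} {C : K -> set K} (lambda_card : infinite_cardinal lambda)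
  (delta_cf : is_cf delta lambda) (C_seq : C_sequence [set: K] C).

Lemma C_sequence_unbounded y : y < delta -> exists x, [/\ C delta x, y < x & x < delta].
Proof.
move=> yd; have [[Cd _] [s [subC sminC] [sub smin]]] := C_seq (delta := delta) I.
have sE : s = delta.
  apply/le_anti/andP; split; first by apply: smin => x /ltW.
  rewrite leNgt; apply/negP => sd.
  have [c sc cd] := cf_limit lambda_card delta_cf sd.
  by have := sub _ cd; rewrite leNgt sc.
apply: contrapT => nx; move: yd; rewrite -sE ltNge => /negP; apply.
apply: sminC => x Cx; rewrite leNgt; apply/negP => yx.
by apply: nx; exists x; split=> //; apply: Cd.
Qed.

Lemma C_sequence_rank_cofinal xi : xi < lambda ->
  exists2 x, C delta x & xi <= rank (C delta) x.
Proof.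
move=> xil; apply: contrapT => nx.
have rl : rank (C delta) delta < lambda.
  apply: le_lt_trans xil; apply: rank_le_ub => y Cy _.
  by rewrite ltNge; apply/negP => h; apply: nx; exists y.
apply: (cf_min delta_cf rl); apply: cofinal_rank => y /C_sequence_unbounded[x [Cx yx xd]].
by exists x; split=> //; apply: ltW.
Qed.

Lemma bounded_rank_lt : (exists2 a, is_otp (C delta) a & a <= lambda) ->
  forall x, x < delta -> rank (C delta) x < lambda.
Proof.
move=> [a [f [[fa _ _] fi]] al] x /C_sequence_unbounded[x' [Cx' xx' _]].
apply: lt_le_trans al; apply: le_lt_trans (fa _ Cx').
apply: (@rank_le_map _ _ _ _ f) => [y Cy yx|y z Cy Cz yz _]; apply: fi => //.
exact: lt_trans xx'.
Qed.

End LimitOrdinal.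

Section FillSequence.
Context {theta : K} (nx : K -> K -> K) (tgt : set K -> K -> K).
Context (nx_gt : forall e t, e < nx e t).
Context (nx_near : forall e t, rank [set z | e <= z] (nx e t) < theta).
Local Notation fill := (fill reg nx tgt).
Context (C : K -> set K) (C_seq : C_sequence [set: K] C).

(** The cut at [delta] matters when [C delta] has a largest element, above which [fill] may go on
    past [delta]. *)
Definition fill_sequence delta : set K := fill (C delta) `&` below delta.
Local Notation C' := fill_sequence.

Lemma rank_fill_sequence delta x : x <= delta ->
  rank (C' delta) x = rank (fill (C delta)) x.
Proof.
move=> xd; apply: rank_local => y yx; split=> [[]//|Fy]; split=> //.
exact: lt_le_trans xd.
Qed.

Lemma fill_C_sequence : C_sequence [set: K] C'.
Proof.
move=> delta _; have [Ccl [s [subC sminC] lub]] := C_seq (delta := delta) I.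
have [Cd _] := Ccl; split; first exact: (fill_closed reg tgt nx_gt).
exists s => //; split=> [x [_ xd]|u ub]; first by case: lub => + _; apply.
by apply: sminC => x Cx; apply: ub; split; [apply: fill_sub|apply: Cd].
Qed.

(** An accumulation point of cofinality at least [theta] cannot lie inside a gap, so it is one of
    [C delta]; coherence of [C] and locality of [fill] then apply. *)
Lemma fill_sequence_coherent chi : theta <= chi -> coherent chi C -> coherent chi C'.
Proof.
move=> tchi coh delta delta' [[[Fd' d'd] /limit_pointP[ne lim]] [mu mu_cf chi_mu]].
have {}lim : limit_point (fill (C delta)) delta'.
  by apply/limit_pointP; split=> // y /lim[z [[]]]; exists z.
have [[g lg]|nl] := last_belowVlimit (C delta) delta'.
  have [nu nu_theta nu_cof] := fill_limit_cof nx_gt nx_near lg lim.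
  by case: (cf_min mu_cf (lt_le_trans nu_theta (le_trans tchi chi_mu)) nu_cof).
have limC := fill_limit_point lim nl.
have Cd' : C delta delta'.
  by have [[_ Ccl] _] := C_seq (delta := delta) I; apply: Ccl.
have E : C delta' = C delta `&` below delta'.
  by apply: coh; split=> //; exists mu.
have loc x : x < delta' -> fill (C delta') x <-> fill (C delta) x.
  by apply: fill_local => y yd'; rewrite E; split=> [[]|].
apply/seteqP; split=> x.
  by move=> [/= Fx xd']; split=> //; split; [apply/loc|apply: lt_trans d'd].
by move=> [[Fx _] xd']; split=> //; apply/loc.
Qed.

(** By [fill_local], the new traces with index at least [a] are determined by old traces, and fewer
    than kappa indices remain. If kappa injected into the new traces, one of the two kinds would
    have kappa many. *)
Lemma fill_sequence_weakly_coherent : weakly_coherent C -> weakly_coherent C'.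
Proof.
move=> wc a; split; first exact: card_le_trans (card_image_le _ _) _.
move=> /(card_le_inj set0)[f fran finj].
pose P := [set k | exists2 delta, a <= delta & f k = C' delta `&` below a].
pose Q := [set k | exists2 delta, delta < a & f k = C' delta `&` below a].
have PQ k : P k \/ Q k.
  have [delta _ E] := fran k I; have [ad|da] := leP a delta.
    by left; exists delta.
  by right; exists delta.
have le_f A : [set: K] #<= A -> [set: K] #<= f @` A.
  move=> le_A; apply: card_le_trans le_A _; apply: (injection_card_le (f := f)) => [x|x y _ _].
    by exists x.
  exact: finj.
have [Punb|] := pselect (forall b, exists2 k, P k & b < k).
  have [_ nle] := wc a; apply: nle.
  have {Punb}/le_f le_P := unbounded_card reg Punb.
  apply: card_le_trans le_P (card_le_trans _ (card_image_le (fun B => fill B `&` below a) _)).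
  apply: subset_card_le => _ [k [delta ad E] <-].
  exists (C delta `&` below a); first by exists delta.
  have loc x : x < a -> fill (C delta `&` below a) x <-> fill (C delta) x.
    by apply: fill_local => y ya; split=> [[]|].
  rewrite E; apply/seteqP; split=> x [Fx xa]; split=> //.
    by split; [apply/loc|apply: lt_le_trans ad].
  by case: Fx => Fx _; apply/loc.
move=> /existsNP[b nb]; have {nb}Qunb b' : exists2 k, Q k & b' < k.
  have [k bk] := no_max reg (Order.max b b'); move: bk; rewrite gt_max => /andP[bk b'k].
  exists k => //; case: (PQ k) => // Pk; case: nb; by exists k.
have [_ _ /(_ a)[_ nle] _] := reg; apply: nle.
have {Qunb}/le_f le_Q := unbounded_card reg Qunb.
apply: card_le_trans le_Q (card_le_trans _ (card_image_le (fun e => C' e `&` below a) _)).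
by apply: subset_card_le => _ [k [delta da E] <-]; exists delta.
Qed.

Lemma fill_sequence_bounded S lambda : infinite_cardinal lambda -> theta < lambda ->
  S `<=` E_cf lambda -> bounded_C_sequence S lambda C -> bounded_C_sequence S lambda C'.
Proof.
move=> card_l tl Scf bd delta Sd; have cf := Scf _ Sd.
have rC := bounded_rank_lt card_l cf C_seq (bd _ Sd).
exists (rank (C' delta) delta).
  have -> : C' delta = C' delta `&` below delta by apply/seteqP; split=> x [].
  rewrite [X in is_otp _ X](_ : _ = rank (C' delta) delta); first exact: rank_otp.
  by apply: rank_local => y yd; split=> [[]|].
apply: rank_le_ub => y Cy yd; rewrite rank_fill_sequence ?(ltW yd) //.
exact: (fill_rank_lt tgt nx_gt nx_near card_l tl (cf_regular card_l cf) rC).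
Qed.

End FillSequence.
End CSequence.

(** * Locality of good points, and the choice of index, club and tail *)

Lemma hits_subset d (K : orderType d) (A X Y : set K) : X `<=` Y -> hits A X `<=` hits A Y.
Proof. by move=> XY g [m [lg Am /XY Ym]]; exists m. Qed.

Lemma hits_restrict d (K : orderType d) (A X : set K) (y g : K) :
  hits (A `&` [set x | x <= y]) X g <->
  exists m, [/\ last_below A g m, A m, m <= y & X m].
Proof.
split=> [[m [[[Ag gy] gm lg] [Am my] Xm]]|[m [[Ag gm lg] Am my Xm]]]; exists m; split=> //.
  by split=> // z Az zm; apply: lg => //; split=> //; apply: le_trans my; apply: ltW.
by split=> //; [split=> //; apply: le_trans my; apply: ltW|move=> z [Az _]; apply: lg].
Qed.

Lemma cofinal_colours_subset d (K : orderType d) (lambda theta : K) c eta (B B' : set K) :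
  B `<=` B' -> cofinal_colours lambda theta c eta B `<=` cofinal_colours lambda theta c eta B'.
Proof.
move=> BB' t [tt h]; split=> // xi /h[b [/BB' Bb xib E]].
by exists b.
Qed.

Theorem theorem4p12 (d : Order.disp_t) (kappa : orderType d)
    (kappa_regular : regular_cardinal kappa)
    (theta lambda : kappa)
    (theta_card : infinite_cardinal theta)
    (lambda_card : infinite_cardinal lambda)
    (theta_lt_lambda : theta < lambda)
    (ubd_lambda_theta : ubd lambda (Jbd lambda) theta)
    (S T : set kappa)
    (S_stationary : stationary S)
    (S_cf : S `<=` E_cf lambda)
    (T_stationary : stationary T)
    (T_limit : T `<=` limit_ordinal)
    (C : kappa -> set kappa)
    (C_seq : C_sequence [set: kappa] C)
    (C_guess : CG lambda S T C) :
  exists C' : kappa -> set kappa,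
    C_sequence [set: kappa] C' /\
    [/\ bounded_C_sequence S lambda C',
        weakly_coherent C -> weakly_coherent C',
        forall chi : kappa, infinite_cardinal chi -> theta <= chi ->
          coherent chi C -> coherent chi C'
      & Theta1 S C' T theta].
Proof.
pose rk := rank kappa_regular.
have [c c_lt' c_unb] := ubd_lambda_theta.
have c_lt a b : a < b -> b < lambda -> c a b < theta.
  by move=> ab bl; have [] := c_lt' _ _ ab bl.
have [delta0 [Sdelta0 _]] := S_stationary _ (club_setT kappa_regular).
have lambda_reg := cf_regular lambda_card (S_cf _ Sdelta0).
have [_ [C_bd guess]] := C_guess.
have C_closed delta : closed_in (below delta) (C delta) by have [] := C_seq delta I.
have C_lt delta x : C delta x -> x < delta by have [h _] := C_closed delta; apply: h.
have rk_lt delta x : S delta -> x < delta -> rk (C delta) x < lambda.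
  by move=> Sd; apply: (bounded_rank_lt kappa_regular lambda_card (S_cf _ Sd) C_seq (C_bd _ Sd)).
pose B D delta : set kappa := rk (C delta) @` hits (C delta) (D `&` T).
have B_lt D delta : S delta -> B D delta `<=` below lambda.
  move=> Sd _ [g [m [[_ gm _] Cm _]] <-]; apply: rk_lt => //.
  exact: lt_trans (C_lt _ _ Cm).
have B_mono D D' delta : D `<=` D' -> B D delta `<=` B D' delta.
  move=> DD' _ [g hg <-]; exists g => //; apply: hits_subset hg => x [/DD' ? ?].
  by split.
have B_unb D : club D -> exists2 delta, S delta & forall xi, xi < lambda ->
    exists2 b, B D delta b & xi <= b.
  move=> cD; have [delta Sd [_ lub]] := guess _ cD; exists delta => // xi xil.
  have [x Cx xix] := C_sequence_rank_cofinal kappa_regular lambda_card (S_cf _ Sd) C_seq xil.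
  have [b [bd [m [[Cm bm] mmin] Xm]] xb] : exists2 b, b < delta /\
      next_in (C delta) b (D `&` T) & x < b.
    apply: contrapT => nb; have := C_lt _ _ Cx; rewrite ltNge => /negP; apply.
    apply: lub => b hb; rewrite leNgt; apply/negP => xb.
    by apply: nb; exists b.
  (* Guessing gives some [b] below [m]; its role passes to the predecessor [g] of [m] in [C delta],
     whose index is at least that of [x]. *)
  have [g lg] : exists g, last_below (C delta) g m.
    apply: (last_below_ex kappa_regular (C_closed delta) Cm bm _ Cx (ltW xb)) => y Cy by_.
    exact: mmin.
  exists (rk (C delta) g); first by exists g => //; exists m.
  apply: le_trans xix _; apply: rank_le; case: lg => _ _; apply => //.
  exact: lt_trans bm.
pose E eta D delta := cofinal_colours lambda theta c eta (B D delta).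
have E_mono eta D D' delta : D `<=` D' -> E eta D delta `<=` E eta D' delta.
  by move=> DD'; apply: cofinal_colours_subset; apply: B_mono.
have [|D cD|eta etal etaP] := club_uniformize kappa_regular theta_card (lambda := lambda)
    (S := S) (Q := fun eta D delta => theta <= rk (E eta D delta) theta).
- move=> eta D D' delta DD' /le_trans; apply; apply: rank_sub.
  exact: E_mono.
- have [delta Sd unb] := B_unb _ cD; exists delta; split=> //.
  have [eta etal large] := cofinal_colours_large kappa_regular theta_card lambda_card
    theta_lt_lambda lambda_reg c_lt c_unb (B_lt D delta Sd) unb.
  by exists eta.
have [|D0 cD0 D0P] := club_stabilize (reg := kappa_regular) theta_card lambda_card theta_lt_lambda
    (E_mono eta) _ etaP.
- by move=> D delta t [].
(* The last condition mentions only [D0], so [Q] stays monotone in [D]. *)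
have [||zeta zetal zetaP] := club_uniformize kappa_regular theta_card (lambda := lambda)
    (S := S) (Q := fun zeta D delta => [/\ theta <= rk (E eta (D `&` D0) delta) theta,
      E eta D0 delta `<=` E eta (D `&` D0) delta &
      forall b, B D0 delta b -> zeta <= b -> E eta D0 delta (c eta b)]).
- move=> zeta D D' delta DD' [large sub tail].
  have sub' : E eta (D `&` D0) delta `<=` E eta (D' `&` D0) delta.
    by apply: E_mono => x [/DD' ? ?].
  split=> //; last exact: subset_trans sub'.
  by apply: le_trans large _; apply: rank_sub.
- move=> D cD; have [delta [Sd large sub]] := D0P _ cD; exists delta; split=> //.
  have [zeta zetal tail] := cofinal_colours_tail lambda_card theta_lt_lambda lambda_reg
    c_lt (B D0 delta) etal.
  exists zeta => //; split=> // b Bb zb.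
  by have [] := tail _ Bb (B_lt _ _ Sd _ Bb) zb.
have [h [nx [h_lt nxP]]] := block_colouring kappa_regular theta_card.
pose L A : set kappa := [set c eta (rk A g) | g in
  [set g | hits A (D0 `&` T) g /\ zeta <= rk A g]].
pose tgt A g := rk (L A) (c eta (rk A g)).
have nx_gt e t : e < nx e t by have [] := nxP e t.
have nx_near e t : rk [set z | e <= z] (nx e t) < theta by have [] := nxP e t.
exists (fill_sequence kappa_regular nx tgt C); split.
  exact: fill_C_sequence.
split.
- exact: (fill_sequence_bounded _ nx_gt nx_near C_seq lambda_card theta_lt_lambda).
- exact: fill_sequence_weakly_coherent.
- by move=> chi _ tchi; apply: (fill_sequence_coherent nx_gt nx_near C_seq tchi).
split; first exact: theta_card.1.
exists h => // D cD.
(* A point above [g] closed under [s] leaves room for [theta] ordinals after [g]; this feeds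
   [fill_hit]. *)
have /choice[s sP] : forall g, exists s, rk [set z | g < z] s = theta.
  move=> g; have [|s _ sE] := rank_onto kappa_regular (A := [set z | g < z]) theta; last by exists s.
  move=> a; have [b] := no_max kappa_regular (Order.max g a).
  by rewrite gt_max => /andP[gb ab]; exists b.
have [delta Sd [large sub tail]] := zetaP _ (clubI kappa_regular theta_card cD
  (club_closure_points kappa_regular theta_card s)).
exists delta => // tau tau_theta.
pose E0 := E eta D0 delta.
have [t [Et tt rt]] : exists t, [/\ E0 t, t < theta & rk E0 t = tau].
  apply: rank_surj; apply: lt_le_trans tau_theta _; apply: le_trans large _.
  by apply: rank_sub; apply: E_mono => x [].
(* Past [y] the visible colours are exactly [E0]: all of them have shown up by then, [theta] being
   below the cofinality of [delta], and [tail] excludes any other. *)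
have [y yd LE] : exists2 y, y < delta & forall g, C delta g -> y <= g ->
    L (C delta `&` [set x | x <= g]) = E0.
  have /choice[m mP] : forall t, exists m, m < delta /\ (E0 t -> exists g,
      [/\ last_below (C delta) g m, C delta m, (D0 `&` T) m, zeta <= rk (C delta) g &
          c eta (rk (C delta) g) = t]).
    move=> t'; have [[_ /(_ _ zetal)[_ [[g [m [lg Cm Xm]] <-] zb Et']]]|n] := pselect (E0 t').
      by exists m; split; [apply: C_lt|exists g].
    have [m Cm _] := C_sequence_rank_cofinal kappa_regular lambda_card (S_cf _ Sd) C_seq zetal.
    by exists m; split=> [|/n//]; apply: C_lt.
  have [|x _|y yd hy] := @not_cofinal_bound _ _ theta (below delta) m.
  - exact: (cf_min (S_cf _ Sd)).
  - by have [] := mP x.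
  exists y => // g Cg yg.
  have rkE x : x <= g -> rk (C delta `&` [set x | x <= g]) x = rk (C delta) x.
    move=> xg; apply: rank_local => z zx; split=> [[]|Cz] //; split=> //.
    by apply: le_trans xg; apply: ltW.
  apply/seteqP; split=> [_ [g' [/hits_restrict[m' [lg Cm' mg Xm]] zg'] <-]|t' Et'].
    have g'g : g' <= g by case: lg => _ /ltW + _; move/le_trans; apply.
    rewrite rkE // in zg' *; apply: tail => //.
    by exists g' => //; exists m'.
  have [_ /(_ Et')[g' [lg Cm Xm zg' E']]] := mP t'.
  have mg : m t' <= g by apply: le_trans yg; apply/ltW/hy; case: Et'.
  have g'g : g' <= g by case: lg => _ /ltW + _; move/le_trans; apply.
  exists g'; rewrite /= ?rkE //; split=> //.
  by apply/hits_restrict; exists (m t').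
split=> [b [/ltW //]|u ub]; rewrite leNgt; apply/negP => ud.
have [x [Cx yux xd]] : exists x, [/\ C delta x, Order.max y u < x & x < delta].
  by apply: (C_sequence_unbounded lambda_card (S_cf _ Sd) C_seq); rewrite gt_max yd.
move: yux; rewrite gt_max => /andP[yx ux].
(* [sub] provides the colour [t] at a point [g] from [x] on whose successor lies in [D] and is
   closed under [s], not merely in [D0]. *)
have [_ /(_ _ (rk_lt _ _ Sd xd))[_ [[g [m [lg Cm Xm]] <-] xg cg]]] := sub _ Et.
have {}xg : x <= g.
  by rewrite leNgt; apply/negP => gx; move: xg; rewrite leNgt rank_lt //; case: lg.
have [Cg gm _] := lg; have md := C_lt _ _ Cm.
have sm : s g < m by have [[[_ cl] _] _] := Xm; apply: cl.
have room : theta <= rk [set z | g < z] (s g) by rewrite sP.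
have [b [gb bm Fb rb bnext]] := fill_hit tgt nx_gt nx_near lg Cm sm room.
have bd := lt_trans bm md.
(* The target at [g] is [tau], so [nx] was asked for an ordinal of colour [tau], and the order type
   at [b] is that ordinal. *)
have goalE : h (rk (fill kappa_regular nx tgt (C delta)) b) = tau.
  have tE : tgt (C delta `&` [set x | x <= g]) g = tau.
    rewrite /tgt LE //; last exact: le_trans (ltW yx) xg.
    rewrite [rk (_ `&` _) _](_ : _ = rk (C delta) g) ?cg //.
    by apply: rank_local => z zg; split=> [[]|Cz] //; split=> //; apply: ltW.
  by rewrite /rk rb /goal tE; have [_ _ ->] := nxP (rk (fill kappa_regular nx tgt (C delta)) g) tau.
suff /ub : [set b | [/\ b < delta,
    exists2 o, is_otp (fill_sequence kappa_regular nx tgt C delta `&` below b) o & h o = tau &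
    next_in (fill_sequence kappa_regular nx tgt C delta) b (D `&` T)]] b.
  by rewrite leNgt (lt_trans ux (le_lt_trans xg gb)).
split=> //.
  exists (rk (fill_sequence kappa_regular nx tgt C delta) b); first exact: rank_otp.
  by rewrite /rk rank_fill_sequence ?(ltW bd).
exists m; last by case: Xm => [[[? _] _] ?].
split; first by split=> //; split=> //; apply: fill_sub.
by move=> z [[Fz _] bz]; apply: bnext.
Qed.
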